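(* Let $n\ge 2$ and let $A_1,\dots,A_r\in\mathbb{R}^{n\times n}$ be Metzler matrices with zero row sums. Let $s^1:=1_n$ and let $s^1,s^2,\dots,s^n\in\mathbb{R}^n$ be linearly independent vectors with $Ps^k=s^k$ for $k=2,\dots,n$, where $P:=I-\frac1n1_n1_n'$. Let $S:=\begin{bmatrix}s^1&s^2&\cdots&s^n\end{bmatrix}'$, and for each $i$ let $\bar A_i\in\mathbb{R}^{(n-1)\times(n-1)}$ be the matrix obtained by deleting the first row and the first column of $SA_iS^{-1}$. Then the switched consensus system $$\dot x(t)=A_{\sigma(t)}x(t)$$ uniformly converges to consensus if and only if the $(n-1)$-dimensional linear switched system $$\dot z(t)=\bar A_{\sigma(t)}z(t)$$ is globally uniformly asymptotically stable (GUAS).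
   Context: Prime denotes transpose; $1_n\in\mathbb{R}^n$ is the all-ones column vector; a matrix is Metzler if its off-diagonal entries are nonnegative. A switching law is a piecewise constant function $\sigma:[0,\infty)\to\{1,\dots,r\}$ (finitely many discontinuities on every bounded interval). The system $\dot x=A_{\sigma}x$ converges to consensus for a switching law $\sigma$ if its solution satisfies $\lim_{t\to\infty}x(t,\sigma)=c1_n$ for some $c\in\mathbb{R}$; it uniformly converges to consensus (UCC) if it converges to consensus for every switching law and every initial condition $x(0)=x_0\in\mathbb{R}^n$. GUAS of the system $\dot z=\bar A_\sigma z$ means that its solutions converge to the origin for every switching law and every initial condition $z(0)\in\mathbb{R}^{n-1}$. *)

(* Defs.v *)
From mathcomp Require Import all_boot all_order all_algebra.
From mathcomp Require Import all_classical all_reals all_analysis.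

Set Implicit Arguments.
Unset Strict Implicit.
Unset Printing Implicit Defensive.

Import Order.TTheory GRing.Theory Num.Theory.
Import numFieldNormedType.Exports.

Local Open Scope classical_set_scope.
Local Open Scope ring_scope.

Definition first_index (n : nat) (hn : (2 <= n)%N) : 'I_n := Ordinal (ltnW hn).

Definition ones (R : pzRingType) (n : nat) : 'cV[R]_n := const_mx 1.

Definition metzler (R : numDomainType) (n : nat) (A : 'M[R]_n) : Prop :=
  forall i j : 'I_n, i != j -> 0 <= A i j.

Definition zero_row_sums (R : pzRingType) (n : nat) (A : 'M[R]_n) : Prop :=
  forall i : 'I_n, \sum_(j < n) A i j = 0.

Definition averaging_projection (R : fieldType) (n : nat) : 'M[R]_n :=
  1%:M - n%:R^-1 *: (ones R n *m (ones R n)^T).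

Definition stacked_rows (R : Type) (n : nat) (s : 'I_n -> 'cV[R]_n) : 'M[R]_n :=
  \matrix_(k < n) (s k)^T.

Definition reduced_mx (R : comUnitRingType) (n : nat) (i0 : 'I_n)
    (S A : 'M[R]_n) : 'M[R]_n.-1 :=
  row' i0 (col' i0 (S *m A *m invmx S)).

Section switched_systems.
Variable R : realType.

(* Time is [0, +oo[; switching laws and trajectories are total functions on R
   whose values at negative times are never used. Continuity of sigma at t is
   relative to [0, +oo[, its finite codomain being discrete. *)
Definition continuous_law_at (r : nat) (sigma : R -> 'I_r) (t : R) : Prop :=
  \forall u \near within `[0, +oo[ (nbhs t), sigma u = sigma t.

Definition switching_law (r : nat) (sigma : R -> 'I_r) : Prop :=
  forall T : R,
    finite_set [set t | 0 <= t <= T /\ ~ continuous_law_at sigma t].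

(* The differential equation is required at every positive time at which sigma
   is continuous; continuity of x glues the pieces together and attaches them
   to the initial value. *)
Definition solution (n r : nat) (A : 'I_r -> 'M[R]_n) (sigma : R -> 'I_r)
    (x0 : 'cV[R]_n) (x : R -> 'cV[R]_n) : Prop :=
  [/\ x 0 = x0,
      {within `[0, +oo[, continuous x} &
      forall t : R, 0 < t -> continuous_law_at sigma t ->
        is_derive t (1 : R) x (A (sigma t) *m x t)].

(* Solutions exist and are unique on [0, +oo[ for every switching law and
   every initial condition, so "every solution" below is "the solution". *)
Definition converges_to_consensus (n r : nat) (A : 'I_r -> 'M[R]_n)
    (sigma : R -> 'I_r) (x0 : 'cV[R]_n) : Prop :=
  forall x : R -> 'cV[R]_n, solution A sigma x0 x ->
    exists c : R, x t @[t --> +oo] --> c *: ones R n.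

Definition UCC (n r : nat) (A : 'I_r -> 'M[R]_n) : Prop :=
  forall (sigma : R -> 'I_r) (x0 : 'cV[R]_n),
    switching_law sigma -> converges_to_consensus A sigma x0.

Definition GUAS (n r : nat) (A : 'I_r -> 'M[R]_n) : Prop :=
  forall (sigma : R -> 'I_r) (z0 : 'cV[R]_n) (z : R -> 'cV[R]_n),
    switching_law sigma -> solution A sigma z0 z ->
    z t @[t --> +oo] --> (0 : 'cV[R]_n).

End switched_systems.

(* Main.v *)
Require Import Defs.
From mathcomp Require Import all_boot all_order all_algebra.
From mathcomp Require Import all_classical all_reals all_analysis.
From mathcomp Require Import measurable_realfun lra.

Set Implicit Arguments.
Unset Strict Implicit.
Unset Printing Implicit Defensive.

Import Order.TTheory GRing.Theory Num.Theory.
Import numFieldNormedType.Exports.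

Local Open Scope classical_set_scope.
Local Open Scope ring_scope.

(** With [z := row' i0 S *m x] every state splits as [x = m *: ones + D *m z],
    where [m] is the mean of the coordinates and [D] consists of the columns of
    [invmx S] other than the first, which is [n%:R^-1 *: ones]. As the system
    matrices kill [ones], [z] solves the reduced system. If all [z] tend to 0,
    the disagreement [D *m z] vanishes; along a Metzler flow with zero row sums
    the interval spanned by the coordinates never grows, so [m] is Cauchy and
    [x] reaches consensus. Conversely a reduced solution [z] lifts to a full
    solution once [m] is defined as a primitive of a piecewise continuous
    function of [z], and consensus of the lift forces [z] to 0. *)

(** * Limits, derivatives and continuity of matrix-valued functions *)

Section matrix_analysis.
Context {R : realType}.

Lemma mx_cvgP {T : Type} (F : set_system T) {FF : Filter F} m n
    (f : T -> 'M[R]_(m, n)) (l : 'M[R]_(m, n)) :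
  f t @[t --> F] --> l <-> forall i j, f t i j @[t --> F] --> l i j.
Proof.
split=> [fl i j|fl].
  exact: (cvg_comp _ _ fl (@coord_continuous _ m n i j l)).
apply/cvgrPdist_le => /= e e0; near=> t.
rewrite /Num.Def.normr/= mx_normrE (bigmax_le _ (ltW e0))//= => ij _.
rewrite !mxE/=; move: ij; near: t; apply: filter_forall => /= ij.
exact: ((cvgrPdist_le _ _).1 (fl ij.1 ij.2)).
Unshelve. all: by end_near. Qed.

Lemma mulmx_continuous m n p (M : 'M[R]_(m, n)) :
  continuous (fun X : 'M[R]_(n, p) => M *m X).
Proof.
move=> X; apply/(@mx_cvgP _ (nbhs X)) => i j; rewrite mxE.
under eq_cvg do rewrite mxE.
apply: cvg_big => [|k _]; first exact: add_continuous.
by apply: cvgMr; exact: coord_continuous.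
Qed.

Lemma is_derive_mulmx m n p (M : 'M[R]_(m, n)) (x : R -> 'M[R]_(n, p)) t v l :
  is_derive t v x l -> is_derive t v (fun u => M *m x u) (M *m l).
Proof.
move=> [dx xl].
have h : (fun h => h^-1 *: (M *m x (h *: v + t) - M *m x t)) @ 0^' --> M *m l.
  have := cvg_comp _ _ dx (@mulmx_continuous _ _ _ M _).
  rewrite -/('D_v x t) xl.
  apply: cvg_trans; apply: near_eq_cvg; near=> h => /=.
  by rewrite -scalemxAr mulmxBr.
apply: DeriveDef; first by apply/cvg_ex; exists (M *m l).
exact/cvg_lim.
Unshelve. all: by end_near. Qed.

Lemma is_derive_scalel (V : normedModType R) (y : R -> R) (w : V) t v l :
  is_derive t v y l -> is_derive t v (fun u => y u *: w) (l *: w).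
Proof.
move=> [dy yl].
have h : (fun h => h^-1 *: (y (h *: v + t) *: w - y t *: w)) @ 0^' --> l *: w.
  under eq_cvg do rewrite -scalerBl scalerA.
  by rewrite -yl; exact: cvgZr_tmp.
apply: DeriveDef; first by apply/cvg_ex; exists (l *: w).
exact/cvg_lim.
Qed.

Lemma is_derive_coord m n (x : R -> 'M[R]_(m, n)) t v l i j :
  is_derive t v x l -> is_derive t v (fun u => x u i j) (l i j).
Proof.
move=> [dx <-]; apply: DeriveDef; first by have /derivable_mxP := dx; exact.
by rewrite derive_mx// mxE.
Qed.

Lemma within_mulmx m n p (M : 'M[R]_(m, n)) (D : set R)
    (x : R -> 'M[R]_(n, p)) :
  {within D, continuous x} -> {within D, continuous (fun t => M *m x t)}.
Proof.
move=> cx t.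
apply: (@continuous_comp (subspace D) _ _ x); first exact: cx.
exact: mulmx_continuous.
Qed.

Lemma within_coord m n (D : set R) (x : R -> 'M[R]_(m, n)) i j :
  {within D, continuous x} -> {within D, continuous (fun t => x t i j)}.
Proof.
move=> cx t.
apply: (@continuous_comp (subspace D) _ _ x (fun M => M i j)); first exact: cx.
exact: coord_continuous.
Qed.

(** For use with [M := row' i0 S], which sends full solutions to reduced ones. *)
Lemma solution_mulmx n p r (A : 'I_r -> 'M[R]_n) (B : 'I_r -> 'M[R]_p)
    (M : 'M[R]_(p, n)) sigma x0 x :
  (forall i, M *m A i = B i *m M) ->
  solution A sigma x0 x -> solution B sigma (M *m x0) (fun t => M *m x t).
Proof.
move=> AB [x00 cx dx]; split.
- by rewrite x00.
- exact: within_mulmx.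
- move=> t t0 st; rewrite mulmxA -AB -mulmxA.
  by apply: is_derive_mulmx; exact: dx.
Qed.

End matrix_analysis.

(** * Maximum principle along Metzler flows with zero row sums *)

Section max_principle.
Context {R : realType}.

(** Left difference quotients alone decide the sign, so [b] may be the right end of the interval. *)
Lemma derive_ge0_left_max (f : R -> R) a b : a < b -> derivable f b 1 ->
  (forall t, t \in `]a, b[%R -> f t <= f b) -> 0 <= 'D_1 f b.
Proof.
move=> ab df fb; rewrite ['D_1 f b]cvg_at_leftE//; apply: limr_ge.
  rewrite -(cvg_at_leftE (fun h => h^-1 *: ((f \o shift b) _ - f b)))//.
  apply: cvg_trans df; apply: cvg_app.
  move=> A [e e0 Ae]; exists e => // x xe x0; apply: Ae => //.
  exact/ltr0_neq0.
near=> h; apply: mulr_le0.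
  by rewrite invr_le0; apply: ltW; near: h; exists 1 => /=.
rewrite subr_le0 [_%:A]mulr1; apply: fb; near: h.
exists (b - a); first by rewrite /= subr_gt0.
move=> h; rewrite /= sub0r normrN in_itv/= => hb h0.
by rewrite gtrDr h0 andbT; rewrite ltr0_norm// in hb; lra.
Unshelve. all: by end_near. Qed.

(** Zero row sums let [v i 0] be subtracted from every coordinate; the diagonal term then vanishes
    and the others are nonpositive. *)
Lemma metzler_mul_max_le0 n (B : 'M[R]_n) (v : 'cV[R]_n) i :
  metzler B -> zero_row_sums B -> (forall j, v j 0 <= v i 0) ->
  (B *m v) i 0 <= 0.
Proof.
move=> mB zB vi.
have -> : (B *m v) i 0 = \sum_j B i j * (v j 0 - v i 0).
  under eq_bigr do rewrite mulrBr.
  by rewrite sumrB -mulr_suml zB mul0r subr0 mxE.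
apply: sumr_le0 => j _; have [->|ij] := eqVneq i j.
  by rewrite subrr mulr0.
by rewrite mulr_ge0_le0 ?subr_le0//; exact: mB.
Qed.

(** [B] may vary with [t], so the bounds below need no switching law, and the class is stable under
    negating [x]. *)
Definition flow_at n (x : R -> 'cV[R]_n) (t : R) :=
  exists B, [/\ metzler B, zero_row_sums B & is_derive t 1 x (B *m x t)].

(* At a maximum over time and coordinates of [x s j 0 - e * (s - a)] with
   [s > a], the derivative is at most [- e], which is impossible. *)
Lemma flow_le_linear n (x : R -> 'cV[R]_n) a b c e : a <= b -> 0 < e ->
  {within `[a, b], continuous x} ->
  (forall t, t \in `]a, b]%R -> flow_at x t) ->
  (forall i, x a i 0 <= c) -> forall i, x b i 0 <= c + e * (b - a).
Proof.
move=> ab e0 cx dx xa i.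
pose g j s := x s j 0 - e * (s - a).
have cg j : {within `[a, b], continuous (g j)}.
  have cl : {within `[a, b], continuous (fun s => e * (s - a))}.
    apply: continuous_subspaceT => u.
    by apply: cvgMr; apply: cvgB; [exact: cvg_id|exact: cvg_cst].
  by move=> s; apply: cvgB; [exact: (within_coord cx)|exact: cl].
have /choice[m mP] j : exists m, m \in `[a, b]%R /\
    forall t, t \in `[a, b]%R -> g j t <= g j m.
  by have [m ? ?] := EVT_max ab (cg j); exists m.
have [j _ jmax] := @arg_maxP _ _ _ i xpredT (fun j => g j (m j)) isT.
have gmax k t : t \in `[a, b]%R -> g k t <= g j (m j).
  by move=> tab; apply: (le_trans ((mP k).2 _ tab)); exact: jmax.
suff mja : m j = a.
  have := gmax i b; rewrite mja /g subrr mulr0 subr0 lerBlDr => h.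
  apply: (le_trans (h _)); first by rewrite in_itv/= lexx ab.
  by rewrite lerD2r.
have := (mP j).1; rewrite in_itv/= => /andP[amj mjb].
apply/eqP; rewrite eq_le amj andbT leNgt; apply/negP => {}amj.
have [|B [mB zB dB]] := dx (m j); first by rewrite in_itv/= amj.
have dg : is_derive (m j) 1 (g j) ((B *m x (m j)) j 0 - e).
  apply: is_deriveB; first exact: is_derive_coord.
  by apply: is_derive_eq; rewrite subr0 [e%:A]mulr1.
have [dg1 dg2] := dg.
have : 0 <= 'D_1 (g j) (m j).
  apply: (derive_ge0_left_max amj) => // t; rewrite in_itv/= => /andP[at_ tm].
  by apply: gmax; rewrite in_itv/= (ltW at_)/= (le_trans (ltW tm) mjb).
rewrite dg2 leNgt => /negP; apply.
(* The penalty depends on time only, so at time [m j] coordinate [j] is also the largest coordinate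
   of [x]. *)
rewrite subr_lt0 (le_lt_trans _ e0)//; apply: metzler_mul_max_le0 => // k.
by have := gmax k (m j) (mP j).1; rewrite /g lerD2r.
Qed.

(** The equation may fail at [b], so the linear bound is applied up to [t < b] and passed to the
    limit by left continuity. *)
Lemma flow_le_interval n (x : R -> 'cV[R]_n) a b c : a < b ->
  {within `[a, b], continuous x} ->
  (forall t, t \in `]a, b[%R -> flow_at x t) ->
  (forall i, x a i 0 <= c) -> forall i, x b i 0 <= c.
Proof.
move=> ab cx dx xa i; apply/ler_addgt0Pr => e e0.
have ba0 : 0 < b - a by rewrite subr_gt0.
have [_ _ xb] :=
  (continuous_within_itvP _ ab).1 (within_coord (i := i) (j := 0) cx).
apply: (cvgr_to_le xb); near=> t.
have tb : t < b by near: t; exact: nbhs_left_lt.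
have at_ : a < t by near: t; exact: nbhs_left_gt.
have sub : `[a, t] `<=` `[a, b] by apply: subset_itvl; rewrite bnd_simp ltW.
(* The slope [e / (b - a)] keeps the slack at time [t] at most [e]. *)
apply: le_trans
  (flow_le_linear (ltW at_) (e := e / (b - a)) (c := c) _ _ _ _ _) _ => //.
- by rewrite divr_gt0.
- exact: continuous_subspaceW cx.
- move=> s; rewrite in_itv/= => /andP[as_ st].
  by apply: dx; rewrite in_itv/= as_ (le_lt_trans st tb).
- rewrite lerD2l mulrAC ler_pdivrMr// ler_pM2l// lerD2r.
  exact: ltW.
Unshelve. all: by end_near. Qed.

(** Induction on the exceptional times: one inside []a, b[] splits the interval, and the bound
    reached there starts the second piece. *)
Lemma flow_le_seq n (x : R -> 'cV[R]_n) (l : seq R) a b c : a <= b ->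
  {within `[a, b], continuous x} ->
  (forall t, t \in `]a, b[%R -> t \notin l -> flow_at x t) ->
  (forall i, x a i 0 <= c) -> forall i, x b i 0 <= c.
Proof.
elim: l a b => [|d l IH] a b ab cx dx xa.
  move: ab; rewrite le_eqVlt => /predU1P[<-//|ab].
  by apply: (flow_le_interval ab) => // t /dx; exact.
have [dab|dab] := boolP (d \in `]a, b[%R); last first.
  apply: (IH a) => // t tab tl; apply: dx => //; rewrite inE negb_or tl andbT.
  by apply: contraNneq dab => <-.
have [ad db] : a < d /\ d < b by move: dab; rewrite in_itv/= => /andP.
apply: (IH d); first exact: ltW.
- apply: continuous_subspaceW cx; apply: subset_itvr.
  by rewrite bnd_simp ltW.
- move=> t; rewrite in_itv/= => /andP[dt tb] tl; apply: dx.
    by rewrite in_itv/= tb (lt_trans ad dt).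
  by rewrite inE negb_or tl gt_eqF.
apply: (IH a) => //; first exact: ltW.
- apply: continuous_subspaceW cx; apply: subset_itvl.
  by rewrite bnd_simp ltW.
- move=> t; rewrite in_itv/= => /andP[at_ td] tl; apply: dx.
    by rewrite in_itv/= at_ (lt_trans td db).
  by rewrite inE negb_or tl lt_eqF.
Qed.

Lemma flow_atN n (x : R -> 'cV[R]_n) t : flow_at x t -> flow_at (- x) t.
Proof.
move=> [B [mB zB dB]]; exists B; split => //.
by rewrite mulmxN; exact: is_deriveN.
Qed.

(** * Coordinate range of a solution over time *)

Section solution_bounds.
Variables (n r : nat) (A : 'I_r -> 'M[R]_n).
Hypothesis A_metzler : forall i, metzler (A i).
Hypothesis A_row_sums : forall i, zero_row_sums (A i).
Variables (sigma : R -> 'I_r) (x0 : 'cV[R]_n) (x : R -> 'cV[R]_n).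
Hypothesis sigma_law : switching_law sigma.
Hypothesis x_sol : solution A sigma x0 x.

Lemma solution_flow_at T : exists l : seq R, forall t,
  0 < t <= T -> t \notin l -> flow_at x t.
Proof.
have /finite_seqP[l lE] := sigma_law T.
exists l => t /andP[t0 tT] /negP tl; exists (A (sigma t)); split => //.
have [_ _] := x_sol; apply => //; apply: contrapT => st; apply: tl.
have : [set t | 0 <= t <= T /\ ~ continuous_law_at sigma t] t.
  by split => //; rewrite (ltW t0).
by rewrite lE.
Qed.

Lemma solution_within a b : 0 <= a -> {within `[a, b], continuous x}.
Proof.
move=> a0; have [_ cx _] := x_sol; apply: continuous_subspaceW cx => t /=.
by rewrite !in_itv/= andbT => /andP[/(le_trans a0)].
Qed.

Lemma solution_le a b c : 0 <= a <= b ->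
  (forall i, x a i 0 <= c) -> forall i, x b i 0 <= c.
Proof.
move=> /andP[a0 ab]; have [l xl] := solution_flow_at b.
apply: (@flow_le_seq _ _ l) => //; first exact: solution_within.
move=> t; rewrite in_itv/= => /andP[at_ tb]; apply: xl.
by rewrite (le_lt_trans a0 at_) ltW.
Qed.

(** The upper bound applied to [- x], which is again a flow. *)
Lemma solution_ge a b c : 0 <= a <= b ->
  (forall i, c <= x a i 0) -> forall i, c <= x b i 0.
Proof.
move=> /andP[a0 ab] xa i; have [l xl] := solution_flow_at b.
rewrite -lerN2; have -> : - x b i 0 = (- x) b i 0 by rewrite [RHS]mxE.
apply: (@flow_le_seq _ (- x) l a) => //.
- move=> t; apply: continuousN; exact: (solution_within (a := a)).
- move=> t; rewrite in_itv/= => /andP[at_ tb] tl; apply/flow_atN/xl => //.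
  by rewrite (le_lt_trans a0 at_) ltW.
- by move=> j; rewrite [leLHS]mxE lerN2.
Qed.

(* The hull of the coordinates shrinks along the flow, hence the mean value at
   time [T] is almost attained forever once the disagreement [e] is small. *)
Lemma solution_mean_cvg (m : R -> R) (e : R -> 'cV[R]_n) : (0 < n)%N ->
  (forall t, x t = m t *: ones R n + e t) ->
  e t @[t --> +oo] --> (0 : 'cV[R]_n) -> exists c : R, m t @[t --> +oo] --> c.
Proof.
move=> n0 xE e0; apply/cvg_ex; apply/cauchy_cvgP; apply: cauchy_exP => d d0.
(* One quarter bounds the disagreement at [T], another the one at [t], so the means differ by at
   most [d / 2 < d]. *)
have d30 : 0 < d / 4 by rewrite divr_gt0.
have /cvgrPdist_le/(_ _ d30)[M [_ HM]] := e0.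
have eM t i : M < t -> `|e t i 0| <= d / 4.
  move=> /HM; rewrite sub0r normrN; apply: le_trans.
  rewrite [leRHS]/Num.Def.normr/= mx_normrE.
  exact: (le_bigmax _ (fun ij : 'I_n * 'I_1 => `|e t ij.1 ij.2|) (i, 0)).
(* Strictly beyond [M], and nonnegative because the range shrinks only from time 0 on. *)
pose T := Num.max M 0 + 1.
have MT : M < T by rewrite ltr_pwDr// le_max lexx.
have T0 : 0 <= T by rewrite addr_ge0// le_max lexx orbT.
have xE' t i : x t i 0 = m t + e t i 0 by rewrite xE !mxE mulr1.
have up := @solution_le T _ (m T + d / 4).
have dn := @solution_ge T _ (m T - d / 4).
exists (m T); exists T; split; first exact: num_real.
move=> t Tt; rewrite /ball/= ltr_norml.
pose i : 'I_n := Ordinal n0.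
have Tt' : 0 <= T <= t by rewrite T0 ltW.
have := eM t i (lt_trans MT Tt); rewrite ler_norml => /andP[h1 h2].
have {}up := up t Tt' _ i.
have {}dn := dn t Tt' _ i.
have {up} : m t + e t i 0 <= m T + d / 4.
  rewrite -xE'; apply: up => j; rewrite xE' lerD2l.
  by have := eM T j MT; rewrite ler_norml => /andP[].
have {dn} : m T - d / 4 <= m t + e t i 0.
  rewrite -xE'; apply: dn => j; rewrite xE' lerD2l.
  by have := eM T j MT; rewrite ler_norml => /andP[].
lra.
Qed.

End solution_bounds.
End max_principle.

(** * Primitives of piecewise continuous functions *)

Section piecewise_primitive.
Context {R : realType}.
Notation mu := (@lebesgue_measure R).

Lemma measurable_fun_finite_set (D : set R) (f : R -> R) :
  finite_set D -> measurable_fun D f.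
Proof.
move=> fD _ Y _; apply: countable_measurable; first exact: measurable_set1.
exact/finite_set_countable/finite_setIl.
Qed.

(** Any function is measurable on the finite exceptional set, and continuity gives measurability off
    it; boundedness on a set of finite measure does the rest. *)
Lemma integrable_piecewise_continuous (f : R -> R) a b M :
  finite_set [set t | a <= t <= b /\ ~ {for t, continuous f}] ->
  (forall t, t \in `[a, b]%R -> `|f t| <= M) ->
  mu.-integrable `[a, b] (EFin \o f).
Proof.
set D := [set t | _] => fD fM.
have mD : measurable D.
  apply: countable_measurable; first exact: measurable_set1.
  exact: finite_set_countable.
apply: measurable_bounded_integrable => //.
- rewrite /= lebesgue_measure_itv/=; case: ifP => _ //.
  by rewrite -EFinB ltry.
- have -> : `[a, b]%classic = D `|` (`[a, b] `\` D).
    by rewrite setDUK// => t [+ _]; rewrite /= in_itv.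
  apply/measurable_funU => //; first exact: measurableD.
  split; first exact: measurable_fun_finite_set.
  apply: subspace_continuous_measurable_fun; first exact: measurableD.
  apply: continuous_in_subspaceT => t /set_mem[tab tD].
  by apply: contrapT => nft; apply: tD; split => //; rewrite /= in_itv in tab.
- exists M; split; first exact: num_real.
  by move=> N MN t tab; apply: (le_trans (fM _ tab)); exact: ltW.
Qed.

Lemma piecewise_primitive (f : R -> R) :
  (forall T, finite_set [set t | 0 <= t <= T /\ ~ {for t, continuous f}]) ->
  (forall T, exists M, forall t, t \in `[0, T]%R -> `|f t| <= M) ->
  exists F : R -> R, [/\ F 0 = 0, {within `[0, +oo[, continuous F} &
    forall t, 0 < t -> {for t, continuous f} -> is_derive t 1 F (f t)].
Proof.
move=> fD fM; exists (fun t => parameterized_integral mu 0 t f).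
have fi T : mu.-integrable `[0, T] (EFin \o f).
  by have [M ?] := fM T; apply: (@integrable_piecewise_continuous _ _ _ M).
have ltS t : 0 <= t -> 0 < t + 1 :> R by move=> ?; rewrite ltr_wpDl.
(* Integrating up to [t + 1] makes a positive [t] interior, where continuity is two-sided. *)
have cF t : 0 <= t ->
    {within `[0, t + 1], continuous (fun t => parameterized_integral mu 0 t f)}.
  by move=> t0; apply: parameterized_integral_continuous; rewrite ?ltW ?ltS.
split.
- by rewrite /parameterized_integral set_itv1 Rintegral_set1.
- apply/continuous_within_itvcyP; split.
    move=> t; rewrite in_itv/= andbT => t0.
    have /(continuous_within_itvP _ (ltS _ (ltW t0)))[+ _ _] := cF _ (ltW t0).
    by apply; rewrite in_itv/= t0 ltrDl/=.
  by have /(continuous_within_itvP _ (ltS _ (lexx 0)))[] := cF _ (lexx 0).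
- move=> t t0 ft.
  have := @continuous_FTC1_closed _ f 0 t (t + 1) _ (fi _) t0 ft.
  rewrite ltrDl => /(_ ltr01)[dF F'].
  by apply: (DeriveDef dF); rewrite -derive1E.
Qed.

Lemma continuous_law_near r (sigma : R -> 'I_r) t : 0 < t ->
  continuous_law_at sigma t -> \forall u \near t, sigma u = sigma t.
Proof.
move=> t0; rewrite /continuous_law_at near_withinE => st; near=> u.
have u0 : 0 < u by near: u; exact: lt_nbhsr.
have : `[0, +oo[%classic u -> sigma u = sigma t by near: u; exact: st.
by apply; rewrite /= in_itv/= andbT ltW.
Unshelve. all: by end_near. Qed.

(** Supplies the mean component of a lifted trajectory. The integrand is continuous wherever [sigma]
    is locally constant. *)
Lemma switched_primitive p r (b : 'I_r -> 'rV[R]_p) (sigma : R -> 'I_r)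
    (z : R -> 'cV[R]_p) :
  switching_law sigma -> {within `[0, +oo[, continuous z} ->
  exists y : R -> R, [/\ y 0 = 0, {within `[0, +oo[, continuous y} &
    forall t, 0 < t -> continuous_law_at sigma t ->
      is_derive t 1 y ((b (sigma t) *m z t) 0 0)].
Proof.
move=> sl cz; pose f t := (b (sigma t) *m z t) 0 0.
have cbz i : {within `[0, +oo[, continuous (fun t => (b i *m z t) 0 0)}.
  exact/within_coord/within_mulmx.
have cf t : 0 < t -> continuous_law_at sigma t -> {for t, continuous f}.
  move=> t0 st; have /continuous_within_itvcyP[+ _] := cbz (sigma t).
  move=> /(_ t); rewrite in_itv/= andbT => /(_ t0).
  rewrite /prop_for /continuous_at; apply: cvg_trans; apply: near_eq_cvg.
  by move: (continuous_law_near t0 st); apply: filterS => u; rewrite /f => ->.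
have [|T|y [y0 cy dy]] := @piecewise_primitive f.
(* Time 0 joins the exceptions: continuity of [f] there would involve the arbitrary values at
   negative times. *)
- move=> T; apply: (@sub_finite_set _ _ ([set 0] `|`
      [set t | 0 <= t <= T /\ ~ continuous_law_at sigma t])); last first.
    by rewrite finite_setU; split; [exact: finite_set1|exact: sl].
  move=> t /= [/andP[]]; rewrite le_eqVlt => /predU1P[<-|t0] tT nft.
    by left.
  right; split; first by rewrite tT t0 orbT.
  by move=> /(cf _ t0).
- have [T0|T0] := ltP T 0.
    exists 0 => t; rewrite in_itv/= => /andP[t0 tT].
    by have := le_lt_trans (le_trans t0 tT) T0; rewrite ltxx.
  (* Each mode is bounded on [[0, T]] by compactness; summing over the finitely many modes covers
     every switch. *)
  have /choice[M MP] i : exists M, forall t, t \in `[0, T]%R ->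
      `|(b i *m z t) 0 0| <= M.
    have [|c _ cM] := @EVT_max _ (fun t => `|(b i *m z t) 0 0|) _ _ T0.
      move=> t; apply: (@continuous_comp (subspace `[0, T]) _ _
        (fun t => (b i *m z t) 0 0) Num.norm); last exact: norm_continuous.
      apply: (continuous_subspaceW _ (cbz i)) => u /=.
      by rewrite !in_itv/= andbT => /andP[].
    by exists `|(b i *m z c) 0 0|.
  exists (\sum_i `|M i|) => t tT; rewrite (bigD1 (sigma t))//=.
  rewrite (le_trans (MP _ _ tT))// (le_trans (ler_norm _))// lerDl.
  exact: sumr_ge0.
- by exists y; split => // t t0 st; apply: dy => //; exact: cf.
Qed.

End piecewise_primitive.

(** * Block triangular form of the system, and the equivalence *)

Section consensus_coordinates.
Context {R : realType} (n r : nat).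
Variables (A : 'I_r -> 'M[R]_n) (i0 : 'I_n) (s : 'I_n -> 'cV[R]_n).
Hypothesis A_row_sums : forall i, zero_row_sums (A i).
Hypothesis s_first : s i0 = ones R n.
Hypothesis s_free : free [tuple s k | k < n].
Hypothesis s_proj : forall k, k != i0 -> averaging_projection R n *m s k = s k.

Let S := stacked_rows s.
Let C := row' i0 S.
Let D := col' i0 (invmx S).
(** In the basis of columns of [invmx S], [b i] is the row through which the disagreement drives the
    component along [ones]. *)
Let b i := row i0 (col' i0 (S *m A i *m invmx S)).
Let B i := reduced_mx i0 S (A i).

Lemma mulmx_split_index m p (M : 'M[R]_(m, n)) (N : 'M[R]_(n, p)) :
  M *m N = col i0 M *m row i0 N + col' i0 M *m row' i0 N.
Proof.
apply/matrixP => i j; rewrite !mxE (bigD1_ord i0)//= big_ord1 !mxE.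
congr (_ + _).
by apply: eq_bigr => k _; rewrite !mxE.
Qed.

Lemma dim_natr_neq0 : n%:R != 0 :> R.
Proof. by rewrite pnatr_eq0 -lt0n; exact: leq_ltn_trans (ltn_ord i0). Qed.

Lemma stacked_rows_unitmx : S \in unitmx.
Proof.
rewrite -row_free_unit; apply: inj_row_free => v vS.
apply/rowP => k; rewrite mxE.
have /freeP/(_ (fun k => v 0 k)) := s_free; apply.
apply/colP => j; rewrite summxE.
rewrite [RHS]mxE; have /rowP/(_ j) := vS; rewrite [LHS]mxE [RHS]mxE.
apply: etrans.
by apply: eq_bigr => i _; rewrite !mxE -tnth_nth tnth_mktuple.
Qed.

(** The projection subtracts the average from every coordinate, so a fixed vector has average
    zero. *)
Lemma sum_proj_eq0 k : k != i0 -> \sum_j s k j 0 = 0.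
Proof.
move=> /s_proj; rewrite /averaging_projection mulmxBl mul1mx => /eqP.
rewrite subr_eq addrC -subr_eq subrr eq_sym -scalemxAl scalemx_eq0.
rewrite invr_eq0 (negbTE dim_natr_neq0)/= => /eqP/colP/(_ i0).
rewrite [RHS]mxE; apply: etrans.
rewrite -mulmxA !mxE big_ord1 !mxE mul1r.
by apply: eq_bigr => j _; rewrite !mxE mul1r.
Qed.

(** [S] maps [n%:R^-1 *: ones R n] to a basis vector, since its rows other than [i0] sum to zero. *)
Lemma col_invmx_stacked_rows : col i0 (invmx S) = n%:R^-1 *: ones R n.
Proof.
have E : S *m (n%:R^-1 *: ones R n) = delta_mx i0 0.
  apply/colP => k; rewrite -scalemxAr !mxE andbT.
  under eq_bigr do rewrite !mxE mulr1.
  have [->|/sum_proj_eq0->] := eqVneq k i0; last by rewrite mulr0.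
  rewrite s_first; under eq_bigr do rewrite mxE.
  by rewrite sumr_const card_ord mulVf// dim_natr_neq0.
by rewrite colE -E mulKmx// stacked_rows_unitmx.
Qed.

Lemma mul_ones i : A i *m ones R n = 0.
Proof.
apply/colP => k; rewrite !mxE; apply: etrans (A_row_sums i k).
by apply: eq_bigr => j _; rewrite mxE mulr1.
Qed.

(** Column [i0] of [S *m A i *m invmx S] vanishes because [A i] kills [ones]; hence the disagreement
    evolves autonomously. *)
Lemma row'_mulmx_reduced i : C *m A i = B i *m C.
Proof.
have SA : S *m A i = (S *m A i *m invmx S) *m S.
  by rewrite mulmxKV// stacked_rows_unitmx.
have -> : C *m A i = row' i0 (S *m A i).
  by apply/matrixP => k l; rewrite !mxE; apply: eq_bigr => j _; rewrite !mxE.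
have -> : B i *m C = row' i0 (col' i0 (S *m A i *m invmx S) *m row' i0 S).
  by apply/matrixP => k l; rewrite !mxE; apply: eq_bigr => j _; rewrite !mxE.
have c0 : col i0 (S *m A i *m invmx S) = 0.
  rewrite colE -mulmxA -colE col_invmx_stacked_rows -mulmxA -scalemxAr.
  by rewrite mul_ones scaler0 mulmx0.
by rewrite [in LHS]SA mulmx_split_index c0 mul0mx add0r.
Qed.

(** These are the columns other than [i0] of [A i *m invmx S = invmx S *m (S *m A i *m invmx S)]. *)
Lemma mul_complement i : A i *m D = n%:R^-1 *: ones R n *m b i + D *m B i.
Proof.
rewrite -col_invmx_stacked_rows -mulmx_split_index.
have -> : col' i0 (S *m A i *m invmx S) = S *m A i *m D.
  by apply/matrixP => k l; rewrite !mxE; apply: eq_bigr => j _; rewrite !mxE.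
by rewrite !mulmxA mulVmx ?mul1mx// stacked_rows_unitmx.
Qed.

(** Expansion of [v] along the columns of [invmx S], with coefficients [S *m v]. *)
Lemma consensus_decomposition (v : 'cV[R]_n) :
  v = (n%:R^-1 * (row i0 S *m v) 0 0) *: ones R n + D *m (C *m v).
Proof.
rewrite mulrC -scalerA -col_invmx_stacked_rows.
rewrite -{1}(mulKmx stacked_rows_unitmx v) [LHS]mulmx_split_index.
congr (_ + _); last congr (_ *m _).
- apply/colP => k; rewrite !mxE big_ord1 !mxE mulrC; congr (_ * _).
  by apply: eq_bigr => j _; rewrite !mxE.
- by apply/matrixP => k l; rewrite !mxE; apply: eq_bigr => j _; rewrite !mxE.
Qed.

Lemma row'_col'_invmx1 : C *m D = 1%:M.
Proof.
have := mulmxV stacked_rows_unitmx => /(congr1 (fun M => row' i0 (col' i0 M))).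
have -> : row' i0 (col' i0 (1%:M : 'M[R]_n)) = 1%:M.
  by apply/matrixP => k l; rewrite !mxE (inj_eq lift_inj).
move=> <-.
by apply/matrixP => k l; rewrite !mxE; apply: eq_bigr => j _; rewrite !mxE.
Qed.

Lemma row'_mul_ones : C *m ones R n = 0.
Proof.
apply/colP => k; rewrite !mxE.
under eq_bigr do rewrite !mxE mulr1.
by apply: sum_proj_eq0; rewrite eq_sym neq_lift.
Qed.

Lemma UCC_GUAS : UCC A -> GUAS B.
Proof.
move=> ucc sigma z0 z sl [z00 cz dz].
have [y [y0 cy dy]] := switched_primitive b sl cz.
(* [y] weights column [i0] of [invmx S] and [z] the others; starting [y] at 0 is a mere
   normalization. *)
pose x t := y t *: (n%:R^-1 *: ones R n) + D *m z t.
have xsol : solution A sigma (D *m z0) x.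
  split.
  - by rewrite /x y0 scale0r add0r z00.
  - move=> t; apply: cvgD; last exact: (within_mulmx cz).
    by apply: cvgZr_tmp; exact: cy.
  - move=> t t0 st.
    have -> : A (sigma t) *m x t =
        (b (sigma t) *m z t) 0 0 *: (n%:R^-1 *: ones R n) +
        D *m (B (sigma t) *m z t).
      rewrite mulmxDr -!scalemxAr mul_ones !scaler0 add0r !mulmxA.
      rewrite mul_complement mulmxDl -!mulmxA; congr (_ + _).
      by rewrite {1}[b (sigma t) *m z t]mx11_scalar mul_mx_scalar.
    apply: is_deriveD; last exact/is_derive_mulmx/dz.
    exact/is_derive_scalel/dy.
have [c xc] := ucc sigma _ sl _ xsol.
have -> : z = fun t => C *m x t.
  apply/funext => t; rewrite mulmxDr -!scalemxAr row'_mul_ones !scaler0 add0r.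
  by rewrite mulmxA row'_col'_invmx1 mul1mx.
have := cvg_comp _ _ xc (@mulmx_continuous _ _ _ _ C _).
by rewrite -scalemxAr row'_mul_ones scaler0.
Qed.

Lemma GUAS_UCC : (forall i, metzler (A i)) -> GUAS B -> UCC A.
Proof.
move=> mA guas sigma x0 sl x xsol.
have zc := guas _ _ _ sl (solution_mulmx row'_mulmx_reduced xsol).
have := cvg_comp _ _ zc (@mulmx_continuous _ _ _ _ D _).
rewrite mulmx0 => e0.
pose m t := n%:R^-1 * (row i0 S *m x t) 0 0.
have n0 : (0 < n)%N by exact: leq_ltn_trans (ltn_ord i0).
have xE t : x t = m t *: ones R n + D *m (C *m x t).
  exact: consensus_decomposition.
(* Disagreement tending to 0 without a rate does not by itself make the mean converge; here the
   Metzler property enters through the maximum principle. *)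
have [c mc] := solution_mean_cvg mA A_row_sums sl xsol n0 xE e0.
exists c; rewrite -[c *: _]addr0.
under eq_cvg do rewrite xE.
by apply: cvgD => //; exact: cvgZr_tmp.
Qed.

End consensus_coordinates.

Theorem mainTheorem2 (R : realType) (n r : nat) (hn : (2 <= n)%N)
    (A : 'I_r -> 'M[R]_n)
    (A_metzler : forall i : 'I_r, metzler (A i))
    (A_row_sums : forall i : 'I_r, zero_row_sums (A i))
    (s : 'I_n -> 'cV[R]_n)
    (s_first : s (first_index hn) = ones R n)
    (s_free : free [tuple s k | k < n])
    (s_proj : forall k : 'I_n, k != first_index hn ->
       averaging_projection R n *m s k = s k) :
  UCC A <->
  GUAS (fun i : 'I_r => reduced_mx (first_index hn) (stacked_rows s) (A i)).
Proof.
split; first exact: UCC_GUAS.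
exact: GUAS_UCC.
Qed.
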